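(* Let $X\subset\mathbb{R}^s$ be open, let $f=(f_1,\dots,f_n):X\to\mathbb{R}^n$ and $g=(g_1,\dots,g_m):X\to\mathbb{R}^m$, and consider the problem (VP) of minimizing $f(x)$ subject to $g_i(x)\le 0$, $i=1,\dots,m$. Let $\bar x$ be a weak local minimizer of (VP) and let $d\in\mathbb{R}^s$ be a nonzero critical direction at $\bar x$. Suppose that: (i) the functions $g_i$, $i\notin I(\bar x)$, are continuous at $\bar x$; (ii) the functions $f_j$, $j=1,\dots,n$, and $g_i$, $i\in I(\bar x)$, are continuously differentiable; (iii) if $\nabla f_j(\bar x)d=0$, then $f_j''(\bar x,d)$ exists, and if $\nabla g_i(\bar x)d=0$, $i\in I(\bar x)$, then $g_i''(\bar x,d)$ exists. Suppose that the constraint qualification $\mathrm{cl}(A(\bar x,d))=B(\bar x,d)$ and the Abadie constraint qualification $L(\bar x)=T(S,\bar x)$ hold. Then there exist nonnegative Lagrange multipliers $\lambda=(\lambda_1,\dots,\lambda_n)$, $\lambda\ne 0$, and $\mu=(\mu_1,\dots,\mu_m)$ which satisfy the second-order KKT conditions $$\mu_i g_i(\bar x)=0,\ i=1,\dots,m,\qquad \nabla\mathcal{L}(\bar x)=0,$$ $$\mathcal{L}''(\bar x,d)=\sum_{j=1}^n\lambda_j f_j''(\bar x,d)+\sum_{i\in I(\bar x)}\mu_i g_i''(\bar x,d)\ge 0,$$ where $\mathcal{L}=\sum_{j=1}^n\lambda_jf_j+\sum_{i=1}^m\mu_ig_i$ is the Lagrange function.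
   Context: The feasible set is $S=\{x\in X\mid g_i(x)\le 0,\ i=1,\dots,m\}$, and for $x\in S$ the set of active constraints is $I(x)=\{i\in\{1,\dots,m\}\mid g_i(x)=0\}$. A point $\bar x\in S$ is a weak local minimizer of (VP) if there is a neighbourhood $U$ of $\bar x$ such that there is no $x\in U\cap S$ with $f_j(x)<f_j(\bar x)$ for all $j=1,\dots,n$. A direction $d\in\mathbb{R}^s$ is critical at $x\in S$ if $\nabla f_j(x)d\le 0$ for all $j\in\{1,\dots,n\}$ and $\nabla g_i(x)d\le 0$ for all $i\in I(x)$. $K(\bar x,d)=\{i\in I(\bar x)\mid \nabla g_i(\bar x)d=0\}$. For $h:X\to\mathbb{R}$ Fréchet differentiable at $x$, the second-order directional derivative in direction $u\in\mathbb{R}^s$ is, when it exists as an element of $\mathbb{R}$, the limit $h''(x,u)=\lim_{t\to+0}2t^{-2}[h(x+tu)-h(x)-t\nabla h(x)u]$. For feasible $x$ and a direction $d$, $$A(x,d)=\{z\in\mathbb{R}^s\mid \forall i\in K(x,d)\ \exists\delta_i>0:\ g_i(x+td+\tfrac12t^2z)\le 0\ \ \forall t\in(0,\delta_i)\},$$ $$B(x,d)=\{z\in\mathbb{R}^s\mid \nabla g_i(x)z+g_i''(x,d)\le 0\ \text{for each } i\in K(x,d)\},$$ with $A(x,d)=B(x,d)=\mathbb{R}^s$ if $K(x,d)=\emptyset$. $\mathrm{cl}$ denotes closure. The linearizing cone is $L(\bar x)=\{u\in\mathbb{R}^s\mid \nabla g_i(\bar x)u\le 0,\ i\in I(\bar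 x)\}$. The Bouligand tangent cone $T(S,\bar x)$ is the set of $u\in\mathbb{R}^s$ for which there exist $t_k>0$, $t_k\to 0$, and $u_k\to u$ in $\mathbb{R}^s$ with $\bar x+t_ku_k\in S$ for all positive integers $k$. *)

(* Defs.v *)
From HB Require Import structures.
From mathcomp Require Import all_boot all_order all_algebra.
From mathcomp Require Import all_classical all_reals all_analysis.

Set Implicit Arguments.
Unset Strict Implicit.
Unset Printing Implicit Defensive.

Import Order.TTheory GRing.Theory Num.Theory.
Import numFieldNormedType.Exports.

Local Open Scope classical_set_scope.
Local Open Scope ring_scope.

(* A function on the open set X of R^s is represented by a total function on
   'rV[R]_s whose values outside X are irrelevant: limits, continuity and
   derivatives are only taken at points of X (which is open), and points at
   which inequalities are evaluated are required to be in X.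
   The number written $\nabla h(x) u$ is 'd h x u. *)

Section Calculus.
Variables (R : realType) (s : nat).
Implicit Types (X : set 'rV[R]_s) (h : 'rV[R]_s -> R) (x u : 'rV[R]_s).

Definition gradient h x : 'rV[R]_s := \row_k 'd h x (delta_mx 0 k).

Definition continuously_differentiable X h : Prop :=
  forall x, X x -> differentiable h x /\ {for x, continuous (gradient h)}.

Definition second_quotient h x u (t : R) : R :=
  2 * t ^- 2 * (h (x + t *: u) - h x - t * 'd h x u).

Definition has_second_dderiv h x u : Prop :=
  cvg (second_quotient h x u t @[t --> 0^'+]).

(* Unspecified unless [has_second_dderiv h x u] holds. *)
Definition second_dderiv h x u : R :=
  lim (second_quotient h x u t @[t --> 0^'+]).

End Calculus.

Section Problem.
Variables (R : realType) (s n m : nat) (X : set 'rV[R]_s).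
Variables (f : 'I_n -> 'rV[R]_s -> R) (g : 'I_m -> 'rV[R]_s -> R).
Implicit Types (x d : 'rV[R]_s).

Definition feasible : set 'rV[R]_s :=
  [set x | X x /\ forall i, g i x <= 0].

Definition active x : {set 'I_m} := finset (fun i => g i x == 0).

Definition weak_local_minimizer x : Prop :=
  feasible x /\
  exists2 U : set 'rV[R]_s, nbhs x U &
    ~ exists2 y, (U `&` feasible) y & forall j, f j y < f j x.

Definition critical_direction x d : Prop :=
  (forall j, 'd (f j) x d <= 0) /\
  (forall i, i \in active x -> 'd (g i) x d <= 0).

Definition active_critical x d : {set 'I_m} :=
  finset (fun i => (i \in active x) && ('d (g i) x d == 0)).

Definition second_order_feasible x d : set 'rV[R]_s :=
  [set z | forall i, i \in active_critical x d ->
    exists2 delta : R, 0 < delta & forall t : R, 0 < t < delta ->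
      X (x + t *: d + (2^-1 * t ^+ 2) *: z) /\
      g i (x + t *: d + (2^-1 * t ^+ 2) *: z) <= 0].

Definition second_order_linearized x d : set 'rV[R]_s :=
  [set z | forall i, i \in active_critical x d ->
    'd (g i) x z + second_dderiv (g i) x d <= 0].

Definition linearizing_cone x : set 'rV[R]_s :=
  [set u | forall i, i \in active x -> 'd (g i) x u <= 0].

Definition lagrangian (lam : 'rV[R]_n) (mu : 'rV[R]_m) (x : 'rV[R]_s) : R :=
  \sum_(j < n) lam 0 j * f j x + \sum_(i < m) mu 0 i * g i x.

End Problem.

Definition tangent_cone (R : realType) (s : nat) (S : set 'rV[R]_s)
    (x : 'rV[R]_s) : set 'rV[R]_s :=
  [set u | exists (t : nat -> R) (v : nat -> 'rV[R]_s),
    [/\ forall k, 0 < t k,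
        t k @[k --> \oo] --> (0 : R),
        v k @[k --> \oo] --> u &
        forall k, S (x + t k *: v k)]].

(* Main.v *)
Require Import Defs.
From HB Require Import structures.
From mathcomp Require Import all_boot all_order all_algebra.
From mathcomp Require Import all_classical all_reals all_analysis.
From mathcomp Require Import ring lra.

Set Implicit Arguments.
Unset Strict Implicit.
Unset Printing Implicit Defensive.

Import Order.TTheory GRing.Theory Num.Theory.
Import numFieldNormedType.Exports.

Local Open Scope classical_set_scope.
Local Open Scope ring_scope.

(* By weak local optimality, the system
     [f_j'(x) z + f_j''(x,d) < 0] for the [j] with [f_j'(x) d = 0],
     [g_i'(x) z + g_i''(x,d) <= 0] for the [i] in [K(x,d)]
   has no solution [z]: the first constraint qualification would allow replacing
   [z] by a nearby point for which the arc [x + t d + t^2/2 z] is feasible and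
   decreases every [f_j]. A theorem of the alternative yields multipliers, which
   may however vanish on the objectives. The Abadie qualification yields, again
   by a theorem of the alternative, first-order multipliers that do not. *)

(** * Theorems of the alternative for finitely many linear functionals *)

Lemma scalar_map0 (R : pzRingType) (V : lmodType R) (h : V -> R) :
  scalar h -> h 0 = 0.
Proof. by move=> /(_ (-1) 0 0); rewrite scaler0 add0r mulN1r addNr. Qed.

Lemma scalar_mapZ (R : pzRingType) (V : lmodType R) (h : V -> R) t x :
  scalar h -> h (t *: x) = t * h x.
Proof.
by move=> h_lin; rewrite -[_ *: x]addr0 h_lin (scalar_map0 h_lin) addr0.
Qed.

(* Bartl's proof by induction on the number of functionals. *)
Lemma farkas (R : realFieldType) (V : lmodType R) (I : eqType) (r : seq I)
    (a : I -> V -> R) (c : V -> R) :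
    uniq r -> (forall i, scalar (a i)) -> scalar c ->
    (forall x, (forall i, i \in r -> a i x <= 0) -> c x <= 0) ->
  exists2 u : I -> R, (forall i, 0 <= u i) &
    forall x, c x = \sum_(i <- r) u i * a i x.
Proof.
elim: r a c => [|k r IHr] a c /=.
  move=> _ _ c_lin c_le0; exists (fun=> 0) => // x; rewrite big_nil.
  apply/eqP; rewrite eq_le c_le0//=.
  by have := c_le0 (-1 *: x); rewrite scalar_mapZ// mulN1r oppr_le0; exact.
move=> /andP[kr r_uniq] a_lin c_lin c_le0.
(* If the functionals of [r] alone already force [c] to be nonpositive, [a k] gets multiplier zero.
   Otherwise some [y] violates this, and [a k y] must be positive. *)
have [[y ay cy]|no_y] := pselect (exists2 y,
    (forall i, i \in r -> a i y <= 0) & 0 < c y); last first.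
  have [|u u_ge0 cE] := IHr a c r_uniq a_lin c_lin.
    by move=> x ax; rewrite leNgt; apply/negP => cx; apply: no_y; exists x.
  exists (fun i => if i == k then 0 else u i) => [i|x]; first by case: ifP.
  rewrite big_cons eqxx mul0r add0r cE; apply: eq_big_seq => i ir.
  by case: eqP => // ik; rewrite -ik ir in kr.
have aky : 0 < a k y.
  rewrite ltNge; apply/negP => aky; suff : c y <= 0 by rewrite leNgt cy.
  by apply: c_le0 => i; rewrite inE => /predU1P[->//|/ay].
(* Replacing [x] by its projection [x - (a k x / a k y) y] onto the kernel of
   [a k] along [y] eliminates the functional [a k]. *)
pose p (h : V -> R) x := h x - a k x / a k y * h y.
have p_lin h : scalar h -> scalar (p h).
  by move=> h_lin t x z; rewrite /p h_lin a_lin; ring.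
have [||||u u_ge0 cE] := IHr (fun i => p (a i)) (p c) => //.
- by move=> i; exact: p_lin.
- exact: p_lin.
- move=> x px; rewrite /p.
  have pE h : scalar h -> p h x = h (- (a k x / a k y) *: y + x).
    by move=> h_lin; rewrite h_lin /p; ring.
  rewrite -/(p c x) pE//; apply: c_le0 => i; rewrite inE => /predU1P[->|/px].
    by rewrite -pE// /p divfK ?subrr// gt_eqF.
  by rewrite pE.
(* The value that makes the identity exact at [y]. It is nonnegative because [c y > 0] while every
   [u i * a i y] is nonpositive. *)
pose uk := (c y - \sum_(i <- r) u i * a i y) / a k y.
exists (fun i => if i == k then uk else u i) => [i|x].
  case: ifP => // _; rewrite divr_ge0 ?(ltW aky)// subr_ge0.
  apply: (@le_trans _ _ 0); last exact: ltW.
  by rewrite big_seq sumr_le0// => j jr; rewrite mulr_ge0_le0// ay.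
rewrite big_cons eqxx.
under eq_big_seq => i ir.
  have -> : (i == k) = false by apply/eqP => ik; rewrite -ik ir in kr.
  over.
have := cE x; rewrite /p /=; under eq_bigr do rewrite mulrBr mulrCA.
rewrite sumrB -mulr_sumr /uk => cxE.
have -> : c x = a k x / a k y * c y +
  (\sum_(i <- r) u i * a i x - a k x / a k y * \sum_(i <- r) u i * a i y).
  by rewrite -cxE; ring.
by ring.
Qed.

(* Homogenize in two extra variables [t] and [w]: [a_i z + t alpha_i + w <= 0],
   [w <= t] and [b_j z + t beta_j <= 0] imply [w <= 0], to which Farkas applies;
   [sig] is the multiplier of [w <= t]. *)
Lemma motzkin_affine (R : realFieldType) (V : lmodType R) (I J : finType)
    (P : pred I) (Q : pred J) (a : I -> V -> R) (b : J -> V -> R)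
    (alpha : I -> R) (beta : J -> R) :
    (forall i, scalar (a i)) -> (forall j, scalar (b j)) ->
    ~ (exists z, (forall i, P i -> a i z + alpha i < 0) /\
                 (forall j, Q j -> b j z + beta j <= 0)) ->
  exists (lam : I -> R) (mu : J -> R) (sig : R),
    [/\ (forall i, 0 <= lam i), (forall j, 0 <= mu j) & 0 <= sig] /\
    [/\ (forall i, ~~ P i -> lam i = 0), (forall j, ~~ Q j -> mu j = 0),
      forall z, \sum_i lam i * a i z + \sum_j mu j * b j z = 0,
      \sum_i lam i * alpha i + \sum_j mu j * beta j = sig &
      \sum_i lam i + sig = 1].
Proof.
move=> a_lin b_lin nosol.
have a0 i : a i 0 = 0 := scalar_map0 (a_lin i).
have b0 j : b j 0 = 0 := scalar_map0 (b_lin j).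
pose W := (V * R^o * R^o)%type.
pose h (k : option (I + J)) (x : W) : R := match k with
  | None => x.2 - x.1.2
  | Some (inl i) => a i x.1.1 + x.1.2 * alpha i + x.2
  | Some (inr j) => b j x.1.1 + x.1.2 * beta j end.
pose C k := match k with
  | None => true | Some (inl i) => P i | Some (inr j) => Q j end.
have h_lin k : scalar (h k).
  case: k => [[i|j]|] t [[x1 x2] x3] [[y1 y2] y3] /=;
  rewrite /= ?a_lin ?b_lin /GRing.scale/=; ring.
pose r := [seq k <- index_enum _ | C k].
have r_uniq : uniq r by rewrite filter_uniq// index_enum_uniq.
have c_lin : scalar (fun x : W => x.2 : R) by move=> t [[x1 x2] x3] [].
have [|u u_ge0 uE] := farkas r_uniq h_lin c_lin.
  move=> x hx.
  have {}hx k : C k -> h k x <= 0.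
    by move=> Ck; apply: hx; rewrite mem_filter Ck mem_index_enum.
  move: x hx => [[z t] w] hx; rewrite /= leNgt; apply/negP => w_gt0.
  (* From [0 < w <= t], division by [t] dehomogenizes: [t^-1 *: z] solves the affine system, and the
     term [w] makes the first inequalities strict. *)
  have t_gt0 : 0 < t by have := hx None isT; rewrite /=; lra.
  apply: nosol; exists (t^-1 *: z); split=> [i Pi|j Qj].
    have := hx (Some (inl i)) Pi; rewrite /= => hi.
    rewrite scalar_mapZ// -(pmulr_rlt0 _ t_gt0) mulrDr.
    by rewrite mulVKf ?gt_eqF//; lra.
  have := hx (Some (inr j)) Qj; rewrite /= => hi.
  rewrite scalar_mapZ// -(pmulr_rle0 _ t_gt0) mulrDr.
  by rewrite mulVKf ?gt_eqF//; lra.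
(* Extension by zero turns the sum over the constraints present into a sum over the whole index
   type, which then splits into its three kinds. *)
pose v k := if C k then u k else 0.
have v_ge0 k : 0 <= v k by rewrite /v; case: ifP.
have {uE} vE (x : W) : x.2 = v None * h None x +
    (\sum_i v (Some (inl i)) * h (Some (inl i)) x +
     \sum_j v (Some (inr j)) * h (Some (inr j)) x).
  rewrite uE /r big_filter big_mkcond /=.
  rewrite (eq_bigr (fun k => v k * h k x)); last first.
    by move=> k _; rewrite /v; case: ifP => //; rewrite mul0r.
  rewrite (bigD1 None)//=; congr (_ + _).
  rewrite (reindex_omap Some id)/=; last by case.
  under eq_bigl do rewrite eqxx.
  by rewrite big_sumType.
exists (fun i => v (Some (inl i))), (fun j => v (Some (inr j))), (v None).
split=> //; split.
- by move=> i nP; rewrite /v /= (negbTE nP).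
- by move=> j nQ; rewrite /v /= (negbTE nQ).
(* The three conclusions are the coefficients of [z], [t] and [w] in [vE], read off at [(z, 0, 0)],
   [(0, 1, 0)] and [(0, 0, 1)]. *)
- move=> z; have := vE (z, 0, 0); rewrite /= subr0 mulr0 add0r => vz.
  rewrite [RHS]vz.
  by congr (_ + _); apply: eq_bigr => i _; rewrite mul0r !addr0.
- have := vE (0, 1, 0); rewrite /= sub0r mulrN1 => /eqP.
  rewrite eq_sym addrC subr_eq0 => /eqP <-.
  by congr (_ + _); apply: eq_bigr => i _; rewrite ?a0 ?b0 mul1r add0r ?addr0.
- have := vE (0, 0, 1); rewrite /= subr0 mulr1 addrC => v1; rewrite [RHS]v1.
  congr (_ + _); rewrite [X in _ + X]big1 ?addr0; last first.
    by move=> j _; rewrite b0 mul0r addr0 mulr0.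
  by apply: eq_bigr => i _; rewrite a0 mul0r !add0r mulr1.
Qed.

(** * First- and second-order expansions along arcs *)

Section Calculus.
Variables (R : realType) (s : nat).
Implicit Types (h : 'rV[R]_s -> R) (x u v z d : 'rV[R]_s).

Lemma diff_scalar h x : scalar ('d h x).
Proof. by move=> t u v; exact: linearP. Qed.

Lemma diff_gradientE h x u : 'd h x u = \sum_k u 0 k * gradient h x 0 k.
Proof.
rewrite {1}(row_sum_delta u) linear_sum; apply: eq_bigr => k _.
by rewrite linearZ/= mxE.
Qed.

Lemma differential_cvg h x u : {for x, continuous (gradient h)} ->
  'd h y u @[y --> x] --> 'd h x u.
Proof.
move=> h_cont.
have dE y : 'd h y u = \sum_k u 0 k * gradient h y 0 k.
  exact: diff_gradientE.
have -> : (fun y => 'd h y u) = fun y => \sum_k u 0 k * gradient h y 0 k.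
  exact/funext.
rewrite dE.
apply: (cvg_big (@add_continuous R) (nbhs_filter x)) => k _.
apply: cvgMl_tmp.
exact: (continuous_comp h_cont (@coord_continuous _ _ _ 0 k _)).
Qed.

Lemma diff_remainder h x e : differentiable h x -> 0 < e ->
  \forall y \near (0 : 'rV[R]_s), `|h (x + y) - h x - 'd h x y| <= e * `|y|.
Proof.
move=> /diff_locallyP[_ /eqaddoP hE] e_gt0; near=> y.
have : `|(h \o shift x - (cst (h x) + 'd h x)) y| <= e * `|y|.
  by near: y; exact: hE.
by rewrite !fctE/= opprD addrA [y + x]addrC.
Unshelve. all: by end_near. Qed.

(** Fréchet differentiability controls the remainder uniformly in the direction, so the direction
    may vary with the step. The general filter covers both the sequences of the tangent cone and the
    limit [t --> 0^'+]. *)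
Lemma difference_quotient_cvg (T : Type) (F : set_system T) {FF : Filter F}
    h x u (t : T -> R) (v : T -> 'rV[R]_s) :
    differentiable h x -> (\forall k \near F, 0 < t k) ->
    t k @[k --> F] --> (0 : R) -> v k @[k --> F] --> u ->
  (t k)^-1 * (h (x + t k *: v k) - h x) @[k --> F] --> 'd h x u.
Proof.
move=> h_diff t_gt0 t0 vu.
have tv0 : t k *: v k @[k --> F] --> (0 : 'rV[R]_s).
  by rewrite -[X in _ --> X](scale0r u); exact: cvgZ.
have dv : 'd h x (v k) @[k --> F] --> 'd h x u.
  apply: continuous_cvg vu; exact: diff_continuous.
apply/cvgrPdist_le => e e_gt0.
(* Eventually [v k] has norm below [|u| + 1], so a remainder of at most this constant times the norm
   of [t k *: v k] is at most [e / 2] after division by [t k]. *)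
have e'_gt0 : 0 < e / 2 / (`|u| + 1) by rewrite !divr_gt0// ltr_wpDl.
have small : \forall k \near F, `|'d h x u - 'd h x (v k)| <= e / 2.
  by move/cvgrPdist_le : dv; apply; rewrite divr_gt0.
have v_le : \forall k \near F, `|v k| < `|u| + 1.
  by move/cvgr_norm_lt : vu; apply; rewrite ltrDl.
have o_le := tv0 _ (diff_remainder h_diff e'_gt0).
near=> k.
have tk : 0 < t k by near: k.
set q := _^-1 * _.
have -> : 'd h x u - q = ('d h x u - 'd h x (v k)) -
    (t k)^-1 * (h (x + t k *: v k) - h x - 'd h x (t k *: v k)).
  by rewrite /q (scalar_mapZ _ _ (diff_scalar h x)); field; rewrite gt_eqF.
rewrite (splitr e) (le_trans (ler_normB _ _))// lerD//; first by near: k.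
rewrite normrM gtr0_norm ?invr_gt0// ler_pdivrMl//.
apply: (@le_trans _ _ (e / 2 / (`|u| + 1) * `|t k *: v k|)); first by near: k.
rewrite normrZ gtr0_norm// mulrCA ler_pM2l// mulrAC ler_pdivrMr ?ltr_wpDl//.
by rewrite ler_pM2l ?divr_gt0// ltW//; near: k; exact: v_le.
Unshelve. all: by end_near. Qed.

Lemma differentiable_line h x z (t : R) : differentiable h (x + t *: z) ->
  is_derive t 1 (fun r => h (x + r *: z)) ('d h (x + t *: z) z).
Proof.
move=> h_diff.
have quotE : (fun k : R => k^-1 *: (((fun r => h (x + r *: z)) \o shift t) (k *: 1)
      - h (x + t *: z))) =
    (fun k => k^-1 *: ((h \o shift (x + t *: z)) (k *: z) - h (x + t *: z))).
  apply/funext => k /=; congr (_ *: (h _ - _)).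
  by rewrite -[k *: 1]/(k * 1) mulr1 scalerDl addrCA.
apply: DeriveDef; first by rewrite /derivable quotE; exact: diff_derivable.
by rewrite /derive quotE -deriveE.
Qed.

(* The mean value theorem on the segment from [x + t d] to [x + t d + t^2/2 z];
   plain differentiability at [x] would only give an [o(t)] numerator. *)
Lemma second_order_shift_cvg (X : set 'rV[R]_s) h x d z :
    open X -> X x -> continuously_differentiable X h ->
  2 * t ^- 2 * (h (x + t *: d + (2^-1 * t ^+ 2) *: z) - h (x + t *: d))
    @[t --> 0^'+] --> 'd h x z.
Proof.
move=> openX Xx hC1; apply/cvgrPdist_le => e e_gt0.
have [_ grad_cont] := hC1 _ Xx.
have : \forall y \near x, X y /\ `|'d h x z - 'd h y z| <= e.
  apply: filterI; first exact: open_nbhs_nbhs.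
  by move/(differential_cvg (u := z))/cvgrPdist_le : grad_cont; exact.
move=> /nbhs_normP[r /= r_gt0 ball_r].
near=> t.
have t_gt0 : 0 < t by near: t; exact: nbhs_right_gt.
have t_lt1 : t < 1 by near: t; exact: nbhs_right_lt.
(* For [c <= t^2/2 <= t], the displacement [t d + c z] has norm at most [t (|d| + |z|)], hence below
   [r]: the whole segment stays in the ball. *)
have t_small : t < r / (`|d| + `|z| + 1).
  by near: t; apply: nbhs_right_lt; rewrite divr_gt0// ltr_wpDl ?addr_ge0.
have tt_gt0 : 0 < 2^-1 * t ^+ 2 by rewrite mulr_gt0// exprn_gt0.
have inball c : 0 <= c <= 2^-1 * t ^+ 2 -> X (x + t *: d + c *: z) /\
    `|'d h x z - 'd h (x + t *: d + c *: z) z| <= e.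
  move=> /andP[c_ge0 c_le]; apply: ball_r => /=.
  rewrite -addrA opprD addrA subrr add0r normrN.
  rewrite (le_lt_trans (ler_normD _ _))// !normrZ (ger0_norm c_ge0) gtr0_norm//.
  apply: (@le_lt_trans _ _ (t * (`|d| + `|z| + 1))); last first.
    by rewrite -ltr_pdivlMr// ltr_wpDl ?addr_ge0.
  have ct : c <= t by apply: (le_trans c_le); nra.
  have := ler_wpM2r (normr_ge0 z) ct; nra.
pose phi c := h (x + t *: d + c *: z).
have phi' c : 0 <= c <= 2^-1 * t ^+ 2 ->
    is_derive c 1 phi ('d h (x + t *: d + c *: z) z).
  by move=> /inball[/hC1[h_diff _] _]; exact: differentiable_line.
have [|||c] :=
  @MVT R phi (fun c => 'd h (x + t *: d + c *: z) z) 0 (2^-1 * t ^+ 2).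
- exact: tt_gt0.
- by move=> c; rewrite in_itv/= => /andP[c0 c1]; apply: phi'; rewrite !ltW.
- apply: derivable_within_continuous => c; rewrite in_itv/= => /phi'[]//.
rewrite in_itv/= => /andP[c0 c1]; rewrite /phi scale0r addr0 subr0 => ->.
have -> : forall y : R, 2 * t ^- 2 * (y * (2^-1 * t ^+ 2)) = y.
  by move=> y; field; rewrite gt_eqF.
by have [|_] := inball c; rewrite ?(ltW c0) ?(ltW c1).
Unshelve. all: by end_near. Qed.

(** Telescoping through [h (x + t *: d)]: the displacement along [z] contributes ['d h x z], and the
    straight ray along [d] contributes the second-order derivative. *)
Lemma second_order_expansion_cvg (X : set 'rV[R]_s) h x d z :
    open X -> X x -> continuously_differentiable X h ->
    has_second_dderiv h x d ->
  2 * t ^- 2 * (h (x + t *: d + (2^-1 * t ^+ 2) *: z) - h x - t * 'd h x d)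
    @[t --> 0^'+] --> 'd h x z + second_dderiv h x d.
Proof.
move=> openX Xx hC1 h_d2.
have shift_cvg := @second_order_shift_cvg X h x d z openX Xx hC1.
rewrite (_ : (fun t : R => _) = (fun t =>
    2 * t ^- 2 * (h (x + t *: d + (2^-1 * t ^+ 2) *: z) - h (x + t *: d)) +
    second_quotient h x d t)); first exact: cvgD.
by apply/funext => t; rewrite /second_quotient; ring.
Qed.

Lemma second_order_arc_cvg x d z :
  (x + t *: d + (2^-1 * t ^+ 2) *: z) @[t --> 0^'+] --> x.
Proof.
rewrite -[X in _ --> X](_ : x + 0 *: d + (2^-1 * 0 ^+ 2) *: z = x); last first.
  by rewrite expr0n/= mulr0 !scale0r !addr0.
apply: cvg_at_right_filter; apply: cvgD; first apply: cvgD.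
- exact: cvg_cst.
- exact: cvgZr_tmp.
- by apply: cvgZr_tmp; apply: cvgMl_tmp; exact: exprn_continuous.
Qed.

Lemma first_order_decrease (T : Type) (F : set_system T) {FF : Filter F}
    h x u (t : T -> R) (v : T -> 'rV[R]_s) :
    differentiable h x -> 'd h x u < 0 -> (\forall k \near F, 0 < t k) ->
    t k @[k --> F] --> (0 : R) -> v k @[k --> F] --> u ->
  \forall k \near F, h (x + t k *: v k) < h x.
Proof.
move=> h_diff hu_lt0 t_gt0 t0 vu.
have q_lt0 : \forall k \near F, (t k)^-1 * (h (x + t k *: v k) - h x) < 0.
  exact: (@cvgr_lt _ _ _ _ _ _ (difference_quotient_cvg h_diff t_gt0 t0 vu)).
near=> k.
have tk : 0 < t k by near: k.
have : (t k)^-1 * (h (x + t k *: v k) - h x) < 0 by near: k.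
by rewrite pmulr_rlt0 ?invr_gt0// subr_lt0.
Unshelve. all: by end_near. Qed.

(** The arc is [x + t *: v] with the moving direction [v = d + (t/2) z], which tends to [d]. *)
Lemma arc_first_order_decrease h x d z : differentiable h x -> 'd h x d < 0 ->
  \forall t \near 0^'+, h (x + t *: d + (2^-1 * t ^+ 2) *: z) < h x.
Proof.
move=> h_diff hd_lt0.
have arcE (t : R) :
    x + t *: d + (2^-1 * t ^+ 2) *: z = x + t *: (d + (2^-1 * t) *: z).
  by rewrite scalerDr scalerA addrA; congr (_ + _ *: _); ring.
under eq_near do rewrite arcE.
apply: (first_order_decrease h_diff hd_lt0).
- exact: nbhs_right_gt.
- exact/cvg_at_right_filter/cvg_id.
- rewrite -[X in _ --> X](_ : d + (2^-1 * 0) *: z = d); last first.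
    by rewrite mulr0 scale0r addr0.
  apply: cvgD; first exact: cvg_cst.
  by apply: cvgZr_tmp; apply: cvgMl_tmp; exact/cvg_at_right_filter/cvg_id.
Qed.

Lemma arc_second_order_decrease (X : set 'rV[R]_s) h x d z :
    open X -> X x -> continuously_differentiable X h ->
    has_second_dderiv h x d -> 'd h x d = 0 ->
    'd h x z + second_dderiv h x d < 0 ->
  \forall t \near 0^'+, h (x + t *: d + (2^-1 * t ^+ 2) *: z) < h x.
Proof.
move=> openX Xx hC1 h_d2 hd0 hz.
have q_lt0 : \forall t \near 0^'+,
    2 * t ^- 2 * (h (x + t *: d + (2^-1 * t ^+ 2) *: z) - h x - t * 'd h x d) < 0.
  have q_cvg := @second_order_expansion_cvg X h x d z openX Xx hC1 h_d2.
  exact: (@cvgr_lt _ _ _ _ _ _ q_cvg).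
near=> t.
have t_gt0 : 0 < t by near: t; exact: nbhs_right_gt.
have : 2 * t ^- 2 * (h (x + t *: d + (2^-1 * t ^+ 2) *: z) - h x - t * 'd h x d) < 0.
  by near: t.
by rewrite hd0 mulr0 subr0 pmulr_rlt0 ?subr_lt0// mulr_gt0// invr_gt0 exprn_gt0.
Unshelve. all: by end_near. Qed.

(** Regularity is asked only where the coefficient is nonzero: inactive constraints are merely
    continuous at the minimizer, and their multipliers vanish. *)
Lemma diff_lincomb k (h : 'I_k -> 'rV[R]_s -> R) (c : 'I_k -> R) x :
    (forall i, c i != 0 -> differentiable (h i) x) ->
  is_diff x (fun y => \sum_i c i * h i y) (fun v => \sum_i c i * 'd (h i) x v).
Proof.
move=> h_diff.
pose e i : 'rV[R]_s -> R := fun y => c i * h i y.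
have e_diff i : is_diff x (e i) (fun v => c i * 'd (h i) x v).
  have [ci0|/h_diff hi] := eqVneq (c i) 0.
    rewrite /e ci0.
    rewrite (_ : (fun=> _) = cst 0); last by apply/funext => y; rewrite mul0r.
    rewrite (_ : (fun=> _) = 0); first exact: is_diff_cst.
    by apply/funext => y; rewrite mul0r.
  exact: (is_diffZ (c i) (differentiableP hi)).
have -> : (fun y => \sum_i c i * h i y) = \sum_i e i.
  by apply/funext => y; rewrite fct_sumE.
have -> : (fun v => \sum_i c i * 'd (h i) x v) =
    \sum_i (fun v => c i * 'd (h i) x v).
  by apply/funext => y; rewrite fct_sumE.
elim/big_rec2: _ => [|i f1 f2 _ f_diff]; first exact: is_diff_cst.
exact: is_diffD.
Qed.

Lemma second_quotient_lincomb_cvg k (h : 'I_k -> 'rV[R]_s -> R) (c : 'I_k -> R) x d :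
    (forall i, c i != 0 -> has_second_dderiv (h i) x d) ->
  \sum_i c i * second_quotient (h i) x d t @[t --> 0^'+] -->
    \sum_i c i * second_dderiv (h i) x d.
Proof.
move=> h_d2; apply: (cvg_big (@add_continuous R)) => i _.
have [->|/h_d2 hi] := eqVneq (c i) 0; last exact: cvgMl_tmp.
rewrite mul0r; under eq_cvg do rewrite mul0r.
exact: cvg_cst.
Qed.

End Calculus.

(** * Inconsistent linearized systems and their multipliers *)

Section SecondOrderKKT.
Variables (R : realType) (s n m : nat) (X : set 'rV[R]_s).
Variables (f : 'I_n -> 'rV[R]_s -> R) (g : 'I_m -> 'rV[R]_s -> R).
Implicit Types (x d : 'rV[R]_s) (lam : 'rV[R]_n) (mu : 'rV[R]_m).

(** Along the arc, functions with negative slope along [d] decrease at first order, and objectives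
    with zero slope at second order. Constraints in [active_critical] stay nonpositive by the
    definition of [second_order_feasible], and inactive ones by continuity. *)
Lemma second_order_system_infeasible x d :
    open X -> weak_local_minimizer X f g x -> critical_direction f g x d ->
    (forall i, i \notin active g x -> {for x, continuous (g i)}) ->
    (forall j, continuously_differentiable X (f j)) ->
    (forall i, i \in active g x -> continuously_differentiable X (g i)) ->
    (forall j, 'd (f j) x d = 0 -> has_second_dderiv (f j) x d) ->
    second_order_linearized g x d `<=` closure (second_order_feasible X g x d) ->
  ~ exists z,
    (forall j, 'd (f j) x d == 0 -> 'd (f j) x z + second_dderiv (f j) x d < 0) /\
    (forall i, i \in active_critical g x d ->
      'd (g i) x z + second_dderiv (g i) x d <= 0).
Proof.
move=> openX [[Xx gx_le0] [U Ux noU]] [f_crit g_crit] g_cont fC1 gC1 f_d2 cq.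
move=> [z [fz /cq clz]].
(* The strict objective inequalities are open in [z], so they survive the passage from a point of
   the closure to a nearby point of [second_order_feasible]. *)
have : \forall y \near z, forall j, 'd (f j) x d == 0 ->
    'd (f j) x y + second_dderiv (f j) x d < 0.
  apply: (@filter_forall _ _ (fun j y => 'd (f j) x d == 0 -> _) _
    (nbhs_filter z)) => j.
  have [fd0|fd0] := boolP ('d (f j) x d == 0); last exact: nearW.
  have [f_diff _] := fC1 j _ Xx.
  have : 'd (f j) x y + second_dderiv (f j) x d @[y --> z] -->
      'd (f j) x z + second_dderiv (f j) x d.
    have df_cont : {for z, continuous ('d (f j) x)} by exact: diff_continuous.
    exact: (@cvgD _ _ _ _ (nbhs_filter z) _ _ _ _ df_cont (cvg_cst _)).
  move=> d_cvg; near=> y => _; near: y.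
  exact: (@cvgr_lt _ _ _ _ _ _ d_cvg _ (fz j fd0)).
move=> /clz[{fz clz}z [Az fz]].
have arc_cvg := @second_order_arc_cvg R s x d z.
pose y t := x + t *: d + (2^-1 * t ^+ 2) *: z.
have Uy : \forall t \near 0^'+, U (y t) by exact: arc_cvg.
have Xy : \forall t \near 0^'+, X (y t) by apply: arc_cvg; exact: open_nbhs_nbhs.
have fy : \forall t \near 0^'+, forall j, f j (y t) < f j x.
  apply: filter_forall => j; have [f_diff _] := fC1 j _ Xx.
  have [fd0|fd0] := eqVneq ('d (f j) x d) 0.
    apply: (@arc_second_order_decrease R s X) => //; first exact: f_d2.
    by apply: fz; rewrite fd0.
  by apply: arc_first_order_decrease => //; rewrite lt_neqAle fd0 f_crit.
have gy : \forall t \near 0^'+, forall i, g i (y t) <= 0.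
  apply: filter_forall => i; have [iI|iI] := boolP (i \in active g x).
    have [g_diff _] := gC1 i iI _ Xx.
    have [gd0|gd0] := eqVneq ('d (g i) x d) 0; last first.
      have : \forall t \near 0^'+, g i (y t) < g i x.
        by apply: arc_first_order_decrease => //; rewrite lt_neqAle gd0 g_crit.
      move: iI; rewrite inE => /eqP ->; apply: filterS => t; exact: ltW.
    have /Az[delta delta_gt0 Ad] : i \in active_critical g x d.
      by rewrite inE iI gd0 eqxx.
    near=> t; have [] // := Ad t; apply/andP; split; near: t.
      exact: nbhs_right_gt.
    exact: nbhs_right_lt.
  have gx_lt0 : g i x < 0 by move: iI; rewrite inE lt_neqAle gx_le0 andbT.
  have g_cvg : g i (y t) @[t --> 0^'+] --> g i x.
    by apply: continuous_cvg arc_cvg; exact: g_cont.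
  near=> t; apply: ltW; near: t.
  exact: (@cvgr_lt _ _ _ _ _ _ g_cvg _ gx_lt0).
suff /filter_ex[] : \forall t \near (0 : R)^'+, False by [].
near=> t; apply: noU; exists (y t); last by near: t.
by split; [near: t|split; near: t].
Unshelve. all: by end_near. Qed.

(** A solution [u] would be tangent to the feasible set, and all objectives would decrease along the
    feasible points [x + t k *: v k] approaching [x]. *)
Lemma first_order_system_infeasible x :
    weak_local_minimizer X f g x ->
    (forall j, differentiable (f j) x) ->
    linearizing_cone g x `<=` tangent_cone (feasible X g) x ->
  ~ exists u, (forall j, 'd (f j) x u < 0) /\
    (forall i, i \in active g x -> 'd (g i) x u <= 0).
Proof.
move=> [_ [U Ux noU]] f_diff cq [u [fu /cq[t [v [t_gt0 t0 vu Stv]]]]].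
have arc_cvg : x + t k *: v k @[k --> \oo] --> x.
  rewrite -[X in _ --> X](_ : x + 0 *: u = x); last first.
    by rewrite scale0r addr0.
  exact: (cvgD (cvg_cst x) (cvgZ t0 vu)).
suff /filter_ex[] : \forall k \near \oo, False by [].
have fv : \forall k \near \oo, forall j, f j (x + t k *: v k) < f j x.
  apply: filter_forall => j; apply: first_order_decrease t0 vu => //.
  exact: nearW.
have Uv : \forall k \near \oo, U (x + t k *: v k) by exact: arc_cvg.
near=> k; apply: noU; exists (x + t k *: v k); last by near: k.
by split; [near: k|exact: Stv].
Unshelve. all: by end_near. Qed.

Lemma second_order_multipliers x d :
    critical_direction f g x d ->
    ~ (exists u, (forall j, 'd (f j) x u < 0) /\
       (forall i, i \in active g x -> 'd (g i) x u <= 0)) ->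
    ~ (exists z,
      (forall j, 'd (f j) x d == 0 ->
        'd (f j) x z + second_dderiv (f j) x d < 0) /\
      (forall i, i \in active_critical g x d ->
        'd (g i) x z + second_dderiv (g i) x d <= 0)) ->
  exists (lam : 'I_n -> R) (mu : 'I_m -> R),
    [/\ forall j, 0 <= lam j, forall i, 0 <= mu i & \sum_j lam j != 0] /\
    [/\ forall j, lam j != 0 -> 'd (f j) x d = 0,
        forall i, mu i != 0 -> i \in active_critical g x d,
        forall z, \sum_j lam j * 'd (f j) x z + \sum_i mu i * 'd (g i) x z = 0 &
        0 <= \sum_j lam j * second_dderiv (f j) x d +
             \sum_i mu i * second_dderiv (g i) x d].
Proof.
move=> [f_crit g_crit] no_u no_z.
have f_lin j : scalar ('d (f j) x) by exact: diff_scalar.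
have g_lin i : scalar ('d (g i) x) by exact: diff_scalar.
have [lam [mu [sig [[lam_ge0 mu_ge0 sig_ge0] [lamJ muK stat second sum1]]]]] :=
  motzkin_affine f_lin g_lin no_z.
(* If [lam] vanishes, [mu] certifies that the linearized constraints alone are
   inconsistent; a large multiple of [mu] then corrects the second-order
   condition for first-order multipliers, which complementarity at [d] confines
   to the functions critical along [d]. *)
have [lam0|lam_neq0] := eqVneq (\sum_j lam j) 0; last first.
  exists lam, mu; split=> //; split=> //.
  - by move=> j; apply: contraNeq => /lamJ ->.
  - by move=> i; apply: contraNT => /muK ->.
  - by rewrite second.
have {}lam0 j : lam j = 0 by apply: (psumr_eq0P _ lam0).
have {}sum1 : \sum_i mu i * second_dderiv (g i) x d = 1.
  rewrite -sum1 -second [X in _ = X + _]big1 ?add0r// [X in X + _]big1 ?add0r//.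
  by move=> j _; rewrite lam0 mul0r.
have {}stat z : \sum_i mu i * 'd (g i) x z = 0.
  by rewrite -[RHS](stat z) [X in X + _]big1 ?add0r// => j _; rewrite lam0 mul0r.
(* With zero constants the alternative yields [sig1 = 0], so the normalization gives the first-order
   objective multipliers the sum 1. *)
have [] := @motzkin_affine R _ 'I_n 'I_m xpredT (mem (active g x)) _ _
  (fun=> 0) (fun=> 0) f_lin g_lin.
  move=> [u [fu gu]]; apply: no_u; exists u; split=> [j|i /gu].
    by have := fu j isT; rewrite addr0.
  by rewrite addr0.
move=> lam1 [mu1 [sig1 [[lam1_ge0 mu1_ge0 _] [_ mu1I stat1 second1 sum11]]]].
have sig1E : sig1 = 0.
  by rewrite -second1 !big1 ?addr0// => i _; rewrite mulr0.
(* Evaluated at the critical direction [d], stationarity is a vanishing sum of terms of one sign, so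
   each term is zero. *)
have fterm_le0 j : 0 <= - (lam1 j * 'd (f j) x d).
  by rewrite oppr_ge0; apply: mulr_ge0_le0.
have gterm_le0 i : 0 <= - (mu1 i * 'd (g i) x d).
  rewrite oppr_ge0; have [/g_crit|/mu1I ->] := boolP (i \in active g x).
    exact: mulr_ge0_le0.
  by rewrite mul0r.
have : \sum_j - (lam1 j * 'd (f j) x d) + \sum_i - (mu1 i * 'd (g i) x d) == 0.
  by rewrite !sumrN -opprD stat1 oppr0.
rewrite paddr_eq0 ?sumr_ge0// => /andP[/eqP fsum0 /eqP gsum0].
(* The certificate [mu] has zero gradient part and second-order value 1. Adding [c * mu] thus keeps
   stationarity and raises the second-order value by [c], enough to offset a negative one. *)
pose c := `|\sum_j lam1 j * second_dderiv (f j) x d +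
            \sum_i mu1 i * second_dderiv (g i) x d|.
have sumDc (b : 'I_m -> R) : \sum_i (mu1 i + c * mu i) * b i =
    \sum_i mu1 i * b i + c * \sum_i mu i * b i.
  by rewrite mulr_sumr -big_split/=; apply: eq_bigr => i _; rewrite mulrDl mulrA.
exists lam1, (fun i => mu1 i + c * mu i); split; split=> //.
- by move=> i; rewrite addr_ge0// mulr_ge0// normr_ge0.
- by move: sum11; rewrite sig1E addr0 => ->; exact: oner_neq0.
- move=> j lamj; have /eqP : - (lam1 j * 'd (f j) x d) = 0.
    by apply: (psumr_eq0P _ fsum0).
  by rewrite oppr_eq0 mulf_eq0 (negbTE lamj) => /eqP.
- move=> i; apply: contraNT => iK; rewrite (muK _ iK) mulr0 addr0.
  have [iI|/mu1I ->//] := boolP (i \in active g x).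
  have /eqP : - (mu1 i * 'd (g i) x d) = 0 by apply: (psumr_eq0P _ gsum0).
  rewrite oppr_eq0 mulf_eq0 => /orP[//|gd0].
  by rewrite inE iI gd0 in iK.
- by move=> z; rewrite sumDc stat mulr0 addr0.
- rewrite sumDc sum1 mulr1 addrA -[X in X + _]opprK addrC subr_ge0.
  by rewrite /c -normrN ler_norm.
Qed.

(** * First- and second-order derivatives of the Lagrangian *)

Lemma lagrangian_diff lam mu x :
    (forall j, lam 0 j != 0 -> differentiable (f j) x) ->
    (forall i, mu 0 i != 0 -> differentiable (g i) x) ->
  is_diff x (lagrangian f g lam mu) (fun v =>
    \sum_j lam 0 j * 'd (f j) x v + \sum_i mu 0 i * 'd (g i) x v).
Proof.
move=> f_diff g_diff.
exact: (is_diffD (diff_lincomb f_diff) (diff_lincomb g_diff)).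
Qed.

(** Once the differential of the Lagrangian is identified, its second-order quotient is, for each
    [t], the same combination of the individual quotients. *)
Lemma lagrangian_second_quotient_cvg lam mu x d :
    (forall j, lam 0 j != 0 -> differentiable (f j) x) ->
    (forall i, mu 0 i != 0 -> differentiable (g i) x) ->
    (forall j, lam 0 j != 0 -> has_second_dderiv (f j) x d) ->
    (forall i, mu 0 i != 0 -> has_second_dderiv (g i) x d) ->
  second_quotient (lagrangian f g lam mu) x d t @[t --> 0^'+] -->
    \sum_j lam 0 j * second_dderiv (f j) x d +
    \sum_i mu 0 i * second_dderiv (g i) x d.
Proof.
move=> f_diff g_diff f_d2 g_d2.
have dL : 'd (lagrangian f g lam mu) x d =
    \sum_j lam 0 j * 'd (f j) x d + \sum_i mu 0 i * 'd (g i) x d.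
  have [_ dLE] := lagrangian_diff f_diff g_diff.
  exact: (congr1 (fun h => h d) dLE).
have lincombE k (h : 'I_k -> 'rV[R]_s -> R) (c : 'I_k -> R) t :
    \sum_i c i * second_quotient (h i) x d t =
    2 * t ^- 2 * (\sum_i c i * h i (x + t *: d) - \sum_i c i * h i x
      - t * \sum_i c i * 'd (h i) x d).
  rewrite mulr_sumr -!sumrB mulr_sumr; apply: eq_bigr => i _.
  by rewrite /second_quotient; ring.
rewrite (_ : second_quotient _ x d = fun t =>
    \sum_j lam 0 j * second_quotient (f j) x d t +
    \sum_i mu 0 i * second_quotient (g i) x d t); last first.
  by apply/funext => t; rewrite !lincombE /second_quotient dL /lagrangian; ring.
by apply: cvgD; exact: second_quotient_lincomb_cvg.
Qed.

End SecondOrderKKT.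

(** * Assembly of the second-order KKT conditions *)

Theorem theorem2 (R : realType) (s n m : nat) (X : set 'rV[R]_s)
    (f : 'I_n -> 'rV[R]_s -> R) (g : 'I_m -> 'rV[R]_s -> R)
    (xbar d : 'rV[R]_s)
    (openX : open X)
    (xbar_min : weak_local_minimizer X f g xbar)
    (d_neq0 : d != 0)
    (d_crit : critical_direction f g xbar d)
    (g_cont : forall i, i \notin active g xbar -> {for xbar, continuous (g i)})
    (f_C1 : forall j, continuously_differentiable X (f j))
    (g_C1 : forall i, i \in active g xbar -> continuously_differentiable X (g i))
    (f_d2 : forall j, 'd (f j) xbar d = 0 -> has_second_dderiv (f j) xbar d)
    (g_d2 : forall i, i \in active g xbar -> 'd (g i) xbar d = 0 ->
       has_second_dderiv (g i) xbar d)
    (second_order_cq : closure (second_order_feasible X g xbar d) =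
       second_order_linearized g xbar d)
    (abadie_cq : linearizing_cone g xbar = tangent_cone (feasible X g) xbar) :
  exists (lam : 'rV[R]_n) (mu : 'rV[R]_m),
    [/\ forall j, 0 <= lam 0 j, lam != 0 & forall i, 0 <= mu 0 i] /\
    (forall i, mu 0 i * g i xbar = 0) /\
    (differentiable (lagrangian f g lam mu) xbar /\
     gradient (lagrangian f g lam mu) xbar = 0) /\
    (* every second-order derivative with a nonzero coefficient below exists *)
    (forall j, lam 0 j != 0 -> has_second_dderiv (f j) xbar d) /\
    (forall i, i \in active g xbar -> mu 0 i != 0 ->
       has_second_dderiv (g i) xbar d) /\
    has_second_dderiv (lagrangian f g lam mu) xbar d /\
    second_dderiv (lagrangian f g lam mu) xbar d =
      \sum_(j < n) lam 0 j * second_dderiv (f j) xbar d +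
      \sum_(i in active g xbar) mu 0 i * second_dderiv (g i) xbar d /\
    0 <= second_dderiv (lagrangian f g lam mu) xbar d.
Proof.
have [[Xx _] _] := xbar_min.
have f_diff j : differentiable (f j) xbar by have [] := f_C1 j _ Xx.
have [|z_le|lam [mu [[lam_ge0 mu_ge0 lam_neq0] [lamJ muK stat second]]]] :=
    @second_order_multipliers R s n m f g xbar d d_crit.
- by apply: (first_order_system_infeasible xbar_min f_diff); rewrite abadie_cq.
- by move: z_le; apply: (second_order_system_infeasible (X := X)) => //;
    rewrite second_order_cq.
(* Nonzero constraint multipliers live on [active_critical], exactly where differentiability and
   second-order derivatives are assumed; this also gives complementary slackness. *)
have muI i : mu i != 0 -> i \in active g xbar /\ 'd (g i) xbar d = 0.
  by move/muK; rewrite inE => /andP[? /eqP].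
pose Lam : 'rV[R]_n := \row_j lam j; pose Mu : 'rV[R]_m := \row_i mu i.
have LamE j : Lam 0 j = lam j by rewrite mxE.
have MuE i : Mu 0 i = mu i by rewrite mxE.
have f_diffL j : Lam 0 j != 0 -> differentiable (f j) xbar by [].
have g_diffM i : Mu 0 i != 0 -> differentiable (g i) xbar.
  by rewrite MuE => /muI[iI _]; have [] := g_C1 i iI _ Xx.
have f_d2L j : Lam 0 j != 0 -> has_second_dderiv (f j) xbar d.
  by rewrite LamE => /lamJ/f_d2.
have g_d2M i : Mu 0 i != 0 -> has_second_dderiv (g i) xbar d.
  by rewrite MuE => /muI[iI gd0]; exact: g_d2.
have [L_diff dL] := lagrangian_diff f_diffL g_diffM.
have L_d2 := lagrangian_second_quotient_cvg f_diffL g_diffM f_d2L g_d2M.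
have L_second : second_dderiv (lagrangian f g Lam Mu) xbar d =
    \sum_j Lam 0 j * second_dderiv (f j) xbar d +
    \sum_i Mu 0 i * second_dderiv (g i) xbar d := cvg_lim (@Rhausdorff R) L_d2.
exists Lam, Mu; do !split=> //.
- by move=> j; rewrite LamE.
- apply: contraNneq lam_neq0 => Lam0; apply/eqP/big1 => j _.
  by rewrite -LamE Lam0 mxE.
- by move=> i; rewrite MuE.
- move=> i; rewrite MuE; have [->|/muI[iI _]] := eqVneq (mu i) 0.
    by rewrite mul0r.
  by move: iI; rewrite inE => /eqP ->; rewrite mulr0.
- apply/rowP => k; rewrite !mxE dL -[RHS](stat (delta_mx 0 k)).
  by congr (_ + _); apply: eq_bigr => i _; rewrite ?LamE ?MuE.
- by move=> i _; exact: g_d2M.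
- by apply/cvg_ex; eexists; exact: L_d2.
(* The sum over all constraints reduces to the active ones because [mu] vanishes elsewhere, where
   [second_dderiv] may be unspecified. *)
- rewrite [LHS]L_second; congr (_ + _).
  rewrite [RHS]big_mkcond; apply: eq_bigr => i _; case: ifPn => // iI.
  rewrite MuE; have [->|/muI[]] := eqVneq (mu i) 0; first by rewrite mul0r.
  by rewrite (negbTE iI).
- rewrite L_second; move: second; congr (is_true (0 <= _ + _));
    by apply: eq_bigr => i _; rewrite ?LamE ?MuE.
Qed.
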